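(* Let $R$ be a Noetherian ring with unity. The category $\mathbb{L}_R$ of all left ideals of $R$ is a category with subobjects and every morphism has a canonical factorization. That is, there is a subcategory $\mathcal{P}$ of $\mathbb{L}_R$ such that $(\mathbb{L}_R,\mathcal{P})$ is a category with subobjects and every morphism $f$ of $\mathbb{L}_R$ has a canonical factorization with respect to $\mathcal{P}$.
   Context: For a Noetherian ring $R$ with unity (not assumed commutative), $\mathbb{L}_R$ denotes the category whose objects are all left ideals of $R$ and whose morphisms $A \to B$ are all left $R$-linear maps, i.e. maps $f : A \to B$ with $f(x+y) = f(x)+f(y)$ and $f(rx) = r f(x)$ for all $x,y \in A$, $r \in R$. Composition is the usual composition of maps, and the identity morphisms are the identity maps. For a category $\mathcal{C}$, $\nu\mathcal{C}$ denotes its class of objects, and $gh$ denotes the composite $g\circ h$ (first $h$, then $g$). A preorder is a category $\mathcal{P}$ in which $\mathcal{P}(p,p')$ contains at most one morphism for all objects $p,p'$; it carries the quasi-order $p \subseteq p' \iff \mathcal{P}(p,p') \neq \emptyset$, and $\mathcal{P}$ is a strict preorder if $\subseteq$ is a partial order. Let $\mathcal{C}$ be a category and $\mathcal{P}$ a subcategory of $\mathcal{C}$. The pair $(\mathcal{C},\mathcal{P})$ is a category with subobjects if: (1) $\mathcal{P}$ is a strict preorder with $\nu\mathcal{C} = \nu\mathcal{P}$; (2) every $f\in\mathcal{P}$ is a monomorphism in $\mathcal{C}$; (3) if $f,g \in \mathcal{P}$ and $f = gh$ for some $h \in \mathcal{C}$, then $h \in \mathcal{P}$. The morphisms of $\mathcal{P}$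 are called inclusions. In a category with subobjects $(\mathcal{C},\mathcal{P})$, a canonical factorization of a morphism $f$ of $\mathcal{C}$ is a factorization $f = jq$ where $q$ is an epimorphism in $\mathcal{C}$ and $j$ is an inclusion (a morphism of $\mathcal{P}$). *)

(* Defs.v *)
From HB Require Import structures.
From mathcomp Require Import all_boot all_order all_algebra.
From mathcomp Require Import all_classical.

Set Implicit Arguments.
Unset Strict Implicit.
Unset Printing Implicit Defensive.

Import GRing.Theory.
Local Open Scope classical_set_scope.
Local Open Scope ring_scope.

Record category := Category {
  obj :> Type;
  mor : obj -> obj -> Type;
  mor_id : forall a, mor a a;
  mor_comp : forall a b c, mor b c -> mor a b -> mor a c;
  mor_comp_idl : forall a b (f : mor a b), mor_comp (mor_id b) f = f;
  mor_comp_idr : forall a b (f : mor a b), mor_comp f (mor_id a) = f;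
  mor_compA : forall a b c d (h : mor c d) (g : mor b c) (f : mor a b),
    mor_comp h (mor_comp g f) = mor_comp (mor_comp h g) f }.

Definition monomorphism (C : category) (a b : C) (f : mor a b) :=
  forall (x : C) (g h : mor x a), mor_comp f g = mor_comp f h -> g = h.

Definition epimorphism (C : category) (a b : C) (f : mor a b) :=
  forall (x : C) (g h : mor b x), mor_comp g f = mor_comp h f -> g = h.

Record subcategory (C : category) := Subcategory {
  subobj : set C;
  submor : forall a b : C, set (mor a b);
  submor_dom : forall (a b : C) (f : mor a b), submor f -> subobj a;
  submor_cod : forall (a b : C) (f : mor a b), submor f -> subobj b;
  submor_id : forall a : C, subobj a -> submor (mor_id a);
  submor_comp : forall (a b c : C) (g : mor b c) (f : mor a b),
    submor g -> submor f -> submor (mor_comp g f) }.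

Section SubcategoryCategory.
Variables (C : category) (P : subcategory C).

Definition sub_obj := {a : C | subobj P a}.
Definition sub_mor (a b : sub_obj) := {f : mor (sval a) (sval b) | submor P f}.

Definition sub_id (a : sub_obj) : sub_mor a a :=
  exist _ (mor_id (sval a)) (submor_id (svalP a)).

Definition sub_comp (a b c : sub_obj) (g : sub_mor b c) (f : sub_mor a b) :
    sub_mor a c :=
  exist _ (mor_comp (sval g) (sval f)) (submor_comp (svalP g) (svalP f)).

Lemma sub_comp_idl a b (f : sub_mor a b) : sub_comp (sub_id b) f = f.
Proof. by case: f => f Pf; apply: eq_exist; exact: mor_comp_idl. Qed.

Lemma sub_comp_idr a b (f : sub_mor a b) : sub_comp f (sub_id a) = f.
Proof. by case: f => f Pf; apply: eq_exist; exact: mor_comp_idr. Qed.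

Lemma sub_compA a b c d (h : sub_mor c d) (g : sub_mor b c) (f : sub_mor a b) :
  sub_comp h (sub_comp g f) = sub_comp (sub_comp h g) f.
Proof. by apply: eq_exist; exact: mor_compA. Qed.

Definition category_of_sub : category :=
  Category sub_comp_idl sub_comp_idr sub_compA.

End SubcategoryCategory.

Coercion category_of_sub : subcategory >-> category.

Definition preorder (P : category) := forall (p p' : P) (f g : mor p p'), f = g.

Definition preorder_le (P : category) (p p' : P) : Prop := inhabited (mor p p').

Definition partial_order (T : Type) (le : T -> T -> Prop) :=
  [/\ forall x, le x x,
      forall x y z, le x y -> le y z -> le x z
    & forall x y, le x y -> le y x -> x = y].

Definition strict_preorder (P : category) :=
  preorder P /\ partial_order (@preorder_le P).

Definition category_with_subobjects (C : category) (P : subcategory C) :=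
  [/\ strict_preorder P /\ subobj P = setT,
      forall (a b : C) (f : mor a b), submor P f -> monomorphism f
    & forall (a b c : C) (f : mor a c) (g : mor b c) (h : mor a b),
        submor P f -> submor P g -> f = mor_comp g h -> submor P h].

Definition has_canonical_factorization (C : category) (P : subcategory C)
    (a b : C) (f : mor a b) :=
  exists (c : C) (q : mor a c) (j : mor c b),
    [/\ epimorphism q, submor P j & f = mor_comp j q].

(* A left ideal is a submodule of the left regular module R^o, on which the
   scaling r *: x is the product r * x. *)
Record left_ideal (R : pzRingType) := LeftIdeal {
  ideal_carrier :> set R^o;
  ideal_submod_closed : submod_closed [in ideal_carrier] }.

Definition ideal_type (R : pzRingType) (A : left_ideal R) :=
  {x : R^o | [in ideal_carrier A] x}.

HB.instance Definition _ (R : pzRingType) (A : left_ideal R) :=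
  SubChoice.on (ideal_type A).
HB.instance Definition _ (R : pzRingType) (A : left_ideal R) :=
  GRing.SubChoice_isSubLmodule.Build R R^o [in ideal_carrier A] (ideal_type A)
    (ideal_submod_closed A).

(* Only the chain condition on left ideals, so that a ring which is Noetherian
   on both sides is in particular left_noetherian. *)
Definition left_noetherian (R : pzRingType) :=
  forall A : nat -> left_ideal R, (forall n, A n `<=` A n.+1) ->
  exists n, forall m, (n <= m)%N -> A m = A n :> set R^o.

Section LeftIdealCategory.
Variable R : pzRingType.
Implicit Types A B C D : left_ideal R.

Lemma linear_ext (U V : lmodType R) (f g : {linear U -> V}) : f =1 g -> f = g.
Proof.
case: f g => f [[fD] [fZ]] [g [[gD] [gZ]]] /= /funext fg.
by case: _ / fg in gD gZ *; rewrite (Prop_irrelevance gD fD) (Prop_irrelevance gZ fZ).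
Qed.

Definition ideal_mor A B := {linear ideal_type A -> ideal_type B}.
Definition ideal_id A : ideal_mor A A := idfun.
Definition ideal_comp A B C (g : ideal_mor B C) (f : ideal_mor A B) :
  ideal_mor A C := g \o f.

Lemma ideal_comp_idl A B (f : ideal_mor A B) : ideal_comp (ideal_id B) f = f.
Proof. exact: linear_ext. Qed.

Lemma ideal_comp_idr A B (f : ideal_mor A B) : ideal_comp f (ideal_id A) = f.
Proof. exact: linear_ext. Qed.

Lemma ideal_compA A B C D (h : ideal_mor C D) (g : ideal_mor B C)
    (f : ideal_mor A B) :
  ideal_comp h (ideal_comp g f) = ideal_comp (ideal_comp h g) f.
Proof. exact: linear_ext. Qed.

Definition left_ideal_category : category :=
  Category ideal_comp_idl ideal_comp_idr ideal_compA.

End LeftIdealCategory.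

(* Main.v *)
Require Import Defs.
From mathcomp Require Import all_boot all_algebra.
From HB Require Import structures.
From mathcomp Require Import all_classical.

(** The inclusions are the linear maps [A -> B] that fix the underlying element
    of [R], so that there is one from [A] to [B] exactly when [A] is contained
    in [B], and then only one. Hence they form a strict preorder, ordered by
    containment ([inclusions_strict_preorder]). They are injective, hence
    monomorphisms, and the remaining axiom follows by comparing underlying
    elements ([inclusions_with_subobjects]).

    A morphism [f : A -> B] factors through its image, which is a left ideal
    contained in [B]: first the corestriction of [f], which is surjective and
    hence an epimorphism, then the inclusion of the image in [B]
    ([inclusions_factorization]). Both maps are
    instances of one construction, [ideal_lift]: a linear map from a left ideal
    to [R] with values in a left ideal [C] is a morphism to [C]. *)

Set Implicit Arguments.
Unset Strict Implicit.
Unset Printing Implicit Defensive.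

Import GRing.Theory.
Local Open Scope classical_set_scope.
Local Open Scope ring_scope.

Section LeftIdeals.
Variable R : pzRingType.
Implicit Types A B C : left_ideal R.

Lemma left_ideal_eq A B : A = B :> set R^o -> A = B.
Proof.
case: A B => [A hA] [B hB] /= eqAB; case: _ / eqAB in hB *.
by rewrite (Prop_irrelevance hA hB).
Qed.

Lemma ideal_typeP A (x : ideal_type A) : ideal_carrier A (val x).
Proof. by rewrite -in_setE; exact: (valP x). Qed.

(** Serves twice: with [g := val] it produces the inclusions, and with
    [g := val \o f] the corestriction of [f] to its image. *)
Section Lift.
Variables (A C : left_ideal R) (g : {linear ideal_type A -> R^o}).
Hypothesis gC : forall x, ideal_carrier C (g x).

Let lift (x : ideal_type A) : ideal_type C := exist _ (g x) (mem_set (gC x)).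

Let lift_linear : linear lift.
Proof. by move=> a x y; apply: val_inj; rewrite /= !linearP. Qed.

HB.instance Definition _ :=
  GRing.isLinear.Build R (ideal_type A) (ideal_type C) *:%R lift lift_linear.

Definition ideal_lift : ideal_mor A C := lift.

End Lift.

Definition is_inclusion A B (f : ideal_mor A B) :=
  forall x : ideal_type A, val (f x) = val x.

Lemma inclusion_unique A B (f g : ideal_mor A B) :
  is_inclusion f -> is_inclusion g -> f = g.
Proof.
by move=> fi gi; apply: linear_ext => x; apply: val_inj; rewrite fi gi.
Qed.

(** With [inclusion_exists], this identifies the quasi-order of the inclusions
    with set containment. *)
Lemma inclusion_sub A B (f : ideal_mor A B) : is_inclusion f -> A `<=` B.
Proof.
move=> fi x Ax; pose x' : ideal_type A := exist _ x (mem_set Ax).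
by have := ideal_typeP (f x'); rewrite fi.
Qed.

Lemma inclusion_exists A B :
  A `<=` B -> exists f : ideal_mor A B, is_inclusion f.
Proof.
move=> AB; have valB (x : ideal_type A) : ideal_carrier B (val x) by apply/AB/ideal_typeP.
by exists (ideal_lift valB).
Qed.

Lemma inclusion_mono (A B : left_ideal_category R) (f : mor A B) :
  is_inclusion f -> monomorphism f.
Proof.
move=> fi C g h fgh; apply: linear_ext => x; apply: val_inj.
rewrite -!fi; congr (val _).
exact: (congr1 (fun k : ideal_mor C B => k x) fgh).
Qed.

Lemma surjective_epi (A B : left_ideal_category R) (f : mor A B) :
  (forall y, exists x, (f : ideal_mor A B) x = y) ->
  epimorphism f.
Proof.
move=> fsurj C g h gfh; apply: linear_ext => y; have [x <-] := fsurj y.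
exact: (congr1 (fun k : ideal_mor A C => k x) gfh).
Qed.

Definition inclusions : subcategory (left_ideal_category R).
Proof.
exists setT (fun A B => [set f | is_inclusion f]) => //.
by move=> A B C g f gi fi x; rewrite /= gi fi.
Defined.

(** Antisymmetry holds for the ideals themselves, and not just up to
    isomorphism, because mutual inclusions make the carriers equal and a left
    ideal is determined by its carrier. *)
Lemma inclusions_strict_preorder : strict_preorder inclusions.
Proof.
split.
  by move=> A B [f fi] [g gi]; apply: eq_exist; exact: inclusion_unique.
split; first by move=> A; constructor; exact: mor_id.
  by move=> A B C [f] [g]; constructor; exact: mor_comp g f.
move=> [A IA] [B IB] [f] [g]; apply: eq_exist; apply: left_ideal_eq.
rewrite eqEsubset; split; first exact: inclusion_sub (svalP f).
exact: inclusion_sub (svalP g).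
Qed.

Lemma inclusions_with_subobjects : category_with_subobjects inclusions.
Proof.
split; first by split=> //; exact: inclusions_strict_preorder.
  by move=> A B f; exact: inclusion_mono.
(* If [f = g h] with [f], [g] inclusions, then as elements of [R]
   [h x = g (h x) = f x = x]. *)
by move=> A B C f g h fi gi fgh x; rewrite -gi -fi fgh.
Qed.

Section Image.
Variables (A B : left_ideal R) (f : ideal_mor A B).

Let image_set : set R^o := range (fun x : ideal_type A => val (f x)).

Lemma image_submod_closed : submod_closed [in image_set].
Proof.
split; first by apply/mem_set; exists 0; rewrite // !linear0.
move=> a _ _ /set_mem[x _ <-] /set_mem[y _ <-]; apply/mem_set.
by exists (a *: x + y); rewrite // !linearP.
Qed.

Definition ideal_image : left_ideal R := LeftIdeal image_submod_closed.

Lemma ideal_image_sub : ideal_image `<=` B.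
Proof. by move=> _ [x _ <-]; exact: ideal_typeP. Qed.

Lemma ideal_image_val (x : ideal_type A) : ideal_carrier ideal_image (val (f x)).
Proof. by exists x. Qed.

End Image.

Lemma inclusions_factorization
    (A B : left_ideal_category R) (f : mor A B) :
  has_canonical_factorization inclusions f.
Proof.
have [j ji] := inclusion_exists (@ideal_image_sub A B f).
pose g : {linear ideal_type A -> R^o} := val \o (f : ideal_mor A B).
pose q := @ideal_lift A (ideal_image f) g (@ideal_image_val A B f).
exists (ideal_image f), q, j; split=> //.
  apply: surjective_epi => y; have [x _ fxy] := ideal_typeP y.
  by exists x; apply: val_inj.
by apply: linear_ext => x; apply: val_inj; rewrite /= ji.
Qed.

End LeftIdeals.

Theorem theorem3p8 (R : pzRingType) (R_noetherian : left_noetherian R) :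
  exists P : subcategory (left_ideal_category R),
    category_with_subobjects P /\
    (forall (A B : left_ideal_category R) (f : mor A B),
        has_canonical_factorization P f).
Proof.
exists (inclusions R); split; first exact: inclusions_with_subobjects.
exact: inclusions_factorization.
Qed.
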